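(* Let $n\geq 1$, let $X$ be a non-empty set and let $(F,r_F)$, with map $i\colon X\to F$, be the free object on $X$ in the category $\mathcal{RNS}_n$ of solutions that are right nilpotent of class at most $n$. Let $G(F,r_F)$ be its structure skew brace and $g_F\colon F\to G(F,r_F)$ the canonical map. Then $G(F,r_F)$, together with $g_F\circ i\colon X\to G(F,r_F)$, is the free object on $X$ in the category $\mathcal{RN}_n$ of skew braces that are right nilpotent of class at most $n$.
   Context: A (left) skew brace is a triple $(B,+,\circ)$ with $(B,+)$ and $(B,\circ)$ groups such that $a\circ(b+c)=a\circ b-a+a\circ c$ for all $a,b,c$. Put $\lambda_a(b)=-a+a\circ b$, $a*b=\lambda_a(b)-b$, and let $\bar a$ be the inverse of $a$ in $(B,\circ)$. Put $B^{(1)}=B$ and let $B^{(k+1)}=B^{(k)}*B$ be the subgroup of $(B,+)$ generated by all $a*b$ with $a\in B^{(k)}$, $b\in B$. $B$ is right nilpotent of class at most $n$ if $B^{(n+1)}=\{0\}$. A solution is a pair $(X,r)$ with $X$ a non-empty set and $r\colon X^2\to X^2$ a bijection with $(r\times\mathrm{id})(\mathrm{id}\times r)(r\times\mathrm{id})=(\mathrm{id}\times r)(r\times\mathrm{id})(\mathrm{id}\times r)$, such that, writing $r(x,y)=(\lambda_x(y),\rho_y(x))$, all $\lambda_x,\rho_x$ are bijective. A morphism $f\colon(X,r)\to(Y,s)$ is a map with $(f\times f)r=s(f\times f)$. Each skew brace $B$ yields a solution $r_B(a,b)=(\lambda_a(b),\overline{\lambda_a(b)}\circ a\circ b)$. Structure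 skew brace: $(G(X,r),\circ)=\langle X\mid x\circ y=u\circ v\text{ whenever } r(x,y)=(u,v)\rangle$, with the second group operation $+$ determined on generators by $x+y=x\circ\lambda_x^{-1}(y)$; the canonical map $g_X\colon X\to G(X,r)$ is universal among morphisms of solutions from $(X,r)$ to solutions $(B,r_B)$ of skew braces $B$. Right nilpotent solutions: for a solution $(X,r)$ let $W(X)$ be the submonoid of $X^X$ generated by all $\lambda_x^{\pm1},\rho_x^{\pm1}$ ($x\in X$) and all maps $D_z\colon X\to X$, $D_z(x)=\rho_x(z)$ ($z\in X$); write $m\cdot x$ for the action of $m\in W(X)$ on $x\in X$. For $k\ge1$, $\alpha=(\alpha_1,\dots,\alpha_k)\in\{\pm1\}^k$, $v=(v_1,\dots,v_k)\in X^k$, $m=(m_2,\dots,m_k)\in W(X)^{k-1}$, define $\lambda^{\alpha}_{m,v}\colon X\to X$ recursively: for $k=1$ it is $\lambda_{v_1}^{\alpha_1}$; for $k>1$ it is $\lambda_{z}^{\alpha_k}$ with $z=m_k\cdot\lambda^{(\alpha_1,\dots,\alpha_{k-1})}_{(m_2,\dots,m_{k-1}),(v_1,\dots,v_{k-1})}(v_k)$. The solution is right nilpotent of class at most $1$ if $\lambda_x=\mathrm{id}$ for all $x$; for $n>1$ it is right nilpotent of class at most $n$ if $\lambda^{(\alpha_1,\dots,\alpha_n)}_{(m_2,\dots,m_n),(v_1,\dots,v_n)}=\lambda^{(\alpha_2,\dots,\alpha_n)}_{(m_3,\dots,m_n),(m_2\cdot v_2,v_3,\dots,v_n)}$ for all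 $\alpha\in\{\pm1\}^n$, $m\in W(X)^{n-1}$, $v\in X^n$. $\mathcal{RNS}_n$ is the full subcategory of such solutions; it has free objects. A free object on a set $X$ in a category of structured sets is an object $F$ with a map $i\colon X\to F$ such that each map from $X$ to an object $K$ factors as $\varphi\circ i$ for a unique morphism $\varphi\colon F\to K$. *)

(* Defs.v *)
From mathcomp Require Import all_boot.
From Stdlib Require Import ClassicalEpsilon.

Set Implicit Arguments.
Unset Strict Implicit.
Unset Printing Implicit Defensive.

(** ** Skew braces *)

Record is_group (T : Type) (op : T -> T -> T) (e : T) (inv : T -> T) : Prop :=
  IsGroup {
    group_assoc : associative op;
    group_left_id : left_id e op;
    group_right_id : right_id e op;
    group_left_inv : left_inverse e inv op;
    group_right_inv : right_inverse e inv op
  }.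

(** The group [(B, +)] need not be abelian.  The units of the two groups are
    separate fields; the brace axiom forces them to coincide. *)
Record skew_brace := SkewBrace {
  brace_carrier :> Type;
  badd : brace_carrier -> brace_carrier -> brace_carrier;
  bzero : brace_carrier;
  bopp : brace_carrier -> brace_carrier;
  bcirc : brace_carrier -> brace_carrier -> brace_carrier;
  bone : brace_carrier;
  binv : brace_carrier -> brace_carrier;
  badd_group : is_group badd bzero bopp;
  bcirc_group : is_group bcirc bone binv;
  brace_axiom : forall a b c,
    bcirc a (badd b c) = badd (badd (bcirc a b) (bopp a)) (bcirc a c)
}.

Definition brace_morphism (A B : skew_brace) (f : A -> B) : Prop :=
  (forall a b, f (badd a b) = badd (f a) (f b)) /\
  (forall a b, f (bcirc a b) = bcirc (f a) (f b)).

Definition blambda (B : skew_brace) (a b : B) : B := badd (bopp a) (bcirc a b).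

Definition bstar (B : skew_brace) (a b : B) : B :=
  badd (blambda a b) (bopp b).

Inductive add_subgroup_gen (B : skew_brace) (S : B -> Prop) : B -> Prop :=
  | add_gen_mem a : S a -> add_subgroup_gen S a
  | add_gen_zero : add_subgroup_gen S (bzero B)
  | add_gen_add a b : add_subgroup_gen S a -> add_subgroup_gen S b ->
      add_subgroup_gen S (badd a b)
  | add_gen_opp a : add_subgroup_gen S a -> add_subgroup_gen S (bopp a).

(** Indices are shifted by one: [right_series B k] is [B^(k+1)], so that
    [right_series B 0] is [B^(1) = B]. *)
Fixpoint right_series (B : skew_brace) (k : nat) : B -> Prop :=
  if k is k'.+1 then
    add_subgroup_gen
      (fun c => exists a b : B, right_series k' a /\ c = bstar a b)
  else fun=> True.

Definition right_nilpotent_brace (n : nat) (B : skew_brace) : Prop :=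
  forall a : B, right_series n a <-> a = bzero B.

(** ** Solutions of the Yang-Baxter equation *)

Section RMaps.
Variables (X : Type) (r : X * X -> X * X).

Definition r12 (t : X * X * X) : X * X * X :=
  let: (x, y, z) := t in (r (x, y), z).

Definition r23 (t : X * X * X) : X * X * X :=
  let: (x, y, z) := t in let: (y', z') := r (y, z) in (x, y', z').

(** [r (x, y) = (lambda_x y, rho_y x)]; note the order of arguments of
    [rmap_rho]. *)
Definition rmap_lambda (x y : X) : X := (r (x, y)).1.
Definition rmap_rho (y x : X) : X := (r (x, y)).2.

End RMaps.

Record solution := Solution {
  sol_carrier :> Type;
  sol_r : sol_carrier * sol_carrier -> sol_carrier * sol_carrier;
  sol_inhabited : inhabited sol_carrier;
  sol_bij : bijective sol_r;
  sol_braid : r12 sol_r \o r23 sol_r \o r12 sol_r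
                =1 r23 sol_r \o r12 sol_r \o r23 sol_r;
  sol_lambda_bij : forall x, bijective (rmap_lambda sol_r x);
  sol_rho_bij : forall x, bijective (rmap_rho sol_r x)
}.

Definition solution_morphism (X Y : solution) (f : X -> Y) : Prop :=
  forall x y : X,
    sol_r (f x, f y) = (f (sol_r (x, y)).1, f (sol_r (x, y)).2).

Lemma bijective_inverse (A B : Type) (f : A -> B) :
  bijective f -> exists g : B -> A, cancel f g /\ cancel g f.
Proof. by case=> g fK gK; exists g. Qed.

Definition inverse (A B : Type) (f : A -> B) (bf : bijective f) : B -> A :=
  proj1_sig (constructive_indefinite_description _ (bijective_inverse bf)).

Lemma inverseK (A B : Type) (f : A -> B) (bf : bijective f) :
  cancel f (inverse bf).
Proof. by rewrite /inverse; case: constructive_indefinite_description => g []. Qed.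

Lemma inverseVK (A B : Type) (f : A -> B) (bf : bijective f) :
  cancel (inverse bf) f.
Proof. by rewrite /inverse; case: constructive_indefinite_description => g []. Qed.

Definition lambda (X : solution) (x : X) : X -> X := rmap_lambda (@sol_r X) x.
Definition rho (X : solution) (x : X) : X -> X := rmap_rho (@sol_r X) x.
Definition lambdaV (X : solution) (x : X) : X -> X :=
  inverse (sol_lambda_bij x).
Definition rhoV (X : solution) (x : X) : X -> X := inverse (sol_rho_bij x).

(** Exponents in [{1, -1}] are booleans: [true] stands for [-1]. *)
Definition lambda_pow (X : solution) (e : bool) (x : X) : X -> X :=
  if e then lambdaV x else lambda x.

(** ** Right nilpotent solutions *)

Inductive in_W (X : solution) : (X -> X) -> Prop :=
  | W_id : in_W (fun x : X => x)
  | W_comp f g : in_W f -> in_W g -> in_W (fun x : X => f (g x))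
  | W_lambda x : in_W (lambda x)
  | W_lambdaV x : in_W (lambdaV x)
  | W_rho x : in_W (rho x)
  | W_rhoV x : in_W (rhoV x)
  | W_D z : in_W (fun x : X => rho x z).

Record W (X : solution) := MkW { W_act :> X -> X; W_actP : in_W W_act }.

(** The data [alpha, m, v] of length [k] are given by the pair
    [(alpha_1, v_1)] and the list of the triples [(alpha_j, m_j, v_j)] for
    [j = 2, ..., k]; the recursion on the last index is then a left fold. *)
Record step (X : solution) := Step {
  step_exp : bool;
  step_m : W X;
  step_v : X
}.

Definition lambda_next (X : solution) (f : X -> X) (s : step X) : X -> X :=
  lambda_pow (step_exp s) (step_m s (f (step_v s))).

Definition lambda_iter (X : solution) (e1 : bool) (v1 : X) (s : seq (step X)) :
    X -> X :=
  foldl (@lambda_next X) (lambda_pow e1 v1) s.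

(** In the case [n = k + 2], [s2] is [(alpha_2, m_2, v_2)] and [s] collects the
    triples of index [3, ..., n].  Only [n >= 1] is meaningful. *)
Definition right_nilpotent_solution (n : nat) (X : solution) : Prop :=
  match n with
  | 0 => False
  | 1 => forall x : X, lambda x =1 id
  | k.+2 => forall (e1 : bool) (v1 : X) (s2 : step X) (s : seq (step X)),
      size s = k ->
      lambda_iter e1 v1 (s2 :: s)
        =1 lambda_iter (step_exp s2) (step_m s2 (step_v s2)) s
  end.

(** ** The structure skew brace *)

(** A word is a list of letters [(e, x)] standing for [x] ([e = false]) or for
    its formal inverse ([e = true]).  [structure_eq] is the congruence whose
    quotient is the group presented by the generators [X] and the relations
    [x y = u v] whenever [r (x, y) = (u, v)]. *)
Inductive structure_eq (X : solution) :
    seq (bool * X) -> seq (bool * X) -> Prop :=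
  | structure_refl w : structure_eq w w
  | structure_sym w w' : structure_eq w w' -> structure_eq w' w
  | structure_trans w w' w'' :
      structure_eq w w' -> structure_eq w' w'' -> structure_eq w w''
  | structure_cat w1 w1' w2 w2' :
      structure_eq w1 w1' -> structure_eq w2 w2' ->
      structure_eq (w1 ++ w2) (w1' ++ w2')
  | structure_cancel e x : structure_eq [:: (e, x); (~~ e, x)] [::]
  | structure_rel x y u v : sol_r (x, y) = (u, v) ->
      structure_eq [:: (false, x); (false, y)] [:: (false, u); (false, v)].

Definition circ_letter (X : Type) (B : skew_brace) (g : X -> B)
    (l : bool * X) : B :=
  if l.1 then binv (g l.2) else g l.2.

Definition circ_word (X : Type) (B : skew_brace) (g : X -> B)
    (w : seq (bool * X)) : B :=
  foldr (fun l b => bcirc (circ_letter g l) b) (bone B) w.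

(** [G] with the map [g] is the structure skew brace of [X]: the circle group
    of [G] is, via [g], the group with the above presentation (evaluation of
    words is onto and identifies exactly the congruent words), and the sum of
    two generators is the prescribed one.  These conditions determine [(G, g)]
    up to a unique isomorphism. *)
Record is_structure_brace (X : solution) (G : skew_brace) (g : X -> G) : Prop :=
  IsStructureBrace {
    structure_gen : forall a : G, exists w, circ_word g w = a;
    structure_presentation : forall w w',
      circ_word g w = circ_word g w' <-> structure_eq w w';
    structure_add : forall x y : X,
      badd (g x) (g y) = bcirc (g x) (g (lambdaV x y))
  }.

(** ** Free objects *)

(** The category has the objects [K : C] with [P K], carriers [car K], and as
    morphisms the maps satisfying [hom].  Equality of maps is pointwise. *)
Definition is_free (C : Type) (car : C -> Type)
    (hom : forall K L : C, (car K -> car L) -> Prop) (P : C -> Prop)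
    (X : Type) (F : C) (i : X -> car F) : Prop :=
  P F /\
  forall K : C, P K -> forall f : X -> car K,
    exists phi : car F -> car K,
      [/\ hom F K phi, phi \o i =1 f &
          forall psi : car F -> car K,
            hom F K psi -> psi \o i =1 f -> psi =1 phi].

Definition is_free_RNS (n : nat) (X : Type) (F : solution) (i : X -> F) : Prop :=
  @is_free solution sol_carrier solution_morphism
    (right_nilpotent_solution n) X F i.

Definition is_free_RN (n : nat) (X : Type) (G : skew_brace) (j : X -> G) : Prop :=
  @is_free skew_brace brace_carrier brace_morphism
    (right_nilpotent_brace n) X G j.

(* Main.v *)
Require Import Defs.
From mathcomp Require Import all_boot.
From Stdlib Require Import ClassicalEpsilon.

Set Implicit Arguments.
Unset Strict Implicit.
Unset Printing Implicit Defensive.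

(** A skew brace [K] in RN_n gives a solution in RNS_n because each [K^(k)]
    defines a brace congruence, so it is preserved by the maps in [W(K)]; with
    the universal property of [G(F)] this gives existence and uniqueness of
    the extensions.

    It remains that [G = G(X)] is in RN_n when [X] is in RNS_n.  The maps
    [lambda_iter] produce congruences on [X]: level 0 is generated by
    [lambda_v x ~ x], level k + 1 by [lambda_x z ~ lambda_y z] for [x ~ y] at
    level k.  Let [L_k] be the normal subgroup of [(G, +)] generated by the
    differences [x - y] with [x ~ y] at level k.  Right nilpotency of [X] says
    that [L_(n-1)] vanishes.  By descending induction on k, every element of
    [L_k] acts trivially, via lambda, modulo [L_(k+1)]; hence [G^(k+2)] is
    contained in [L_k], and [G^(n+1) = 0]. *)

Declare Scope brace_scope.
Local Open Scope brace_scope.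
Notation "a + b" := (badd a b) : brace_scope.
Notation "- a" := (bopp a) : brace_scope.
Notation "a - b" := (badd a (bopp b)) : brace_scope.
Notation "a ∘ b" := (bcirc a b) (at level 40, left associativity) : brace_scope.
Notation "a ^-1" := (binv a) : brace_scope.

(** * Elementary identities in a skew brace *)

Section BraceTheory.
Variable B : skew_brace.
Implicit Types a b c d u v x y z : B.
Notation "0" := (bzero B) : brace_scope.

Lemma baddA : associative (@badd B). Proof. by case: (badd_group B). Qed.
Lemma badd0l : left_id 0 (@badd B). Proof. by case: (badd_group B). Qed.
Lemma badd0r : right_id 0 (@badd B). Proof. by case: (badd_group B). Qed.
Lemma baddNl : left_inverse 0 (@bopp B) (@badd B).
Proof. by case: (badd_group B). Qed.
Lemma baddNr : right_inverse 0 (@bopp B) (@badd B).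
Proof. by case: (badd_group B). Qed.

Lemma baddKl a b : - a + (a + b) = b.
Proof. by rewrite baddA baddNl badd0l. Qed.
Lemma baddKNl a b : a + (- a + b) = b.
Proof. by rewrite baddA baddNr badd0l. Qed.
Lemma baddKr a b : a + b - b = a.
Proof. by rewrite -baddA baddNr badd0r. Qed.
Lemma baddKNr a b : a - b + b = a.
Proof. by rewrite -baddA baddNl badd0r. Qed.
Lemma baddI a : injective (badd a).
Proof. by move=> b c e; rewrite -(baddKl a b) e baddKl. Qed.
Lemma bopp_uniq a b : a + b = 0 -> b = - a.
Proof. by move=> e; rewrite -(baddKl a b) e badd0r. Qed.
Lemma boppK : involutive (@bopp B).
Proof. by move=> a; apply/esym/bopp_uniq/baddNl. Qed.
Lemma bopp0 : - 0 = 0.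
Proof. by apply/esym/bopp_uniq/badd0l. Qed.
Lemma boppD a b : - (a + b) = - b - a.
Proof. by apply/esym/bopp_uniq; rewrite baddA baddKr baddNr. Qed.
Lemma bsub_eq0 a b : a - b = 0 -> a = b.
Proof. by move=> e; rewrite -(baddKNr a b) e badd0l. Qed.

(** The brace axiom at the triple [bone B], [0], [0] collapses to [0 = - bone B]. *)
Lemma bone_zero : bone B = 0.
Proof.
have c1 : left_id (bone B) (@bcirc B) by case: (bcirc_group B).
have := brace_axiom (bone B) 0 0.
by rewrite !c1 badd0l badd0r badd0l => e; rewrite -(boppK (bone B)) -e bopp0.
Qed.

Lemma bcircA : associative (@bcirc B). Proof. by case: (bcirc_group B). Qed.
Lemma bcirc0l : left_id 0 (@bcirc B).
Proof. by rewrite -bone_zero; case: (bcirc_group B). Qed.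
Lemma bcirc0r : right_id 0 (@bcirc B).
Proof. by rewrite -bone_zero; case: (bcirc_group B). Qed.
Lemma bcircVl : left_inverse 0 (@binv B) (@bcirc B).
Proof. by rewrite -bone_zero; case: (bcirc_group B). Qed.
Lemma bcircVr : right_inverse 0 (@binv B) (@bcirc B).
Proof. by rewrite -bone_zero; case: (bcirc_group B). Qed.

Lemma bcircKl a b : a^-1 ∘ (a ∘ b) = b.
Proof. by rewrite bcircA bcircVl bcirc0l. Qed.
Lemma bcircKVl a b : a ∘ (a^-1 ∘ b) = b.
Proof. by rewrite bcircA bcircVr bcirc0l. Qed.
Lemma bcircKr a b : a ∘ b ∘ b^-1 = a.
Proof. by rewrite -bcircA bcircVr bcirc0r. Qed.
Lemma bcircKVr a b : a ∘ b^-1 ∘ b = a.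
Proof. by rewrite -bcircA bcircVl bcirc0r. Qed.
Lemma bcircI a : injective (bcirc a).
Proof. by move=> b c e; rewrite -(bcircKl a b) e bcircKl. Qed.
Lemma binv_uniq a b : a ∘ b = 0 -> b = a^-1.
Proof. by move=> e; rewrite -(bcircKl a b) e bcirc0r. Qed.
Lemma binvK : involutive (@binv B).
Proof. by move=> a; apply/esym/binv_uniq/bcircVl. Qed.
Lemma binv0 : 0^-1 = 0.
Proof. by apply/esym/binv_uniq/bcirc0l. Qed.
Lemma binvM a b : (a ∘ b)^-1 = b^-1 ∘ a^-1.
Proof. by apply/esym/binv_uniq; rewrite bcircA bcircKr bcircVr. Qed.

Lemma bcircE a b : a ∘ b = a + blambda a b.
Proof. by rewrite /blambda baddKNl. Qed.

Lemma blambdaD a b c : blambda a (b + c) = blambda a b + blambda a c.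
Proof. by rewrite /blambda brace_axiom !baddA. Qed.
Lemma blambda0r a : blambda a 0 = 0.
Proof. by rewrite /blambda bcirc0r baddNl. Qed.
Lemma blambdaN a b : blambda a (- b) = - blambda a b.
Proof. by apply: bopp_uniq; rewrite -blambdaD baddNr blambda0r. Qed.
Lemma blambdaM a b c : blambda (a ∘ b) c = blambda a (blambda b c).
Proof.
apply: (@baddI (a ∘ b)); rewrite -bcircE -bcircA [b ∘ c]bcircE.
by rewrite bcircE blambdaD baddA -bcircE.
Qed.
Lemma blambda0l a : blambda 0 a = a.
Proof. by rewrite /blambda bcirc0l bopp0 badd0l. Qed.
Lemma blambdaK a : cancel (blambda a) (blambda a^-1).
Proof. by move=> b; rewrite -blambdaM bcircVl blambda0l. Qed.
Lemma blambdaKV a : cancel (blambda a^-1) (blambda a).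
Proof. by move=> b; rewrite -blambdaM bcircVr blambda0l. Qed.

Lemma baddE a b : a + b = a ∘ blambda a^-1 b.
Proof. by rewrite bcircE blambdaKV. Qed.
(** Apply [baddE] to [- a + a = 0]. With it, subgroups of the circle group can be tested on additive
    inverses. *)
Lemma boppE a : - a = (blambda (- a)^-1 a)^-1.
Proof.
rewrite -[LHS]binvK; congr (_^-1); apply/esym/binv_uniq.
by rewrite -baddE baddNl.
Qed.
Lemma binvE a : a^-1 = - blambda a^-1 a.
Proof.
by apply: (@bcircI a); rewrite bcircVr bcircE blambdaN blambdaKV baddNr.
Qed.

Definition brho b a : B := (blambda a b)^-1 ∘ a ∘ b.

Lemma bcirc_lr a b : blambda a b ∘ brho b a = a ∘ b.
Proof. by rewrite /brho -bcircA bcircKVl. Qed.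
Lemma blambda_circ a b c :
  blambda a (b ∘ c) = blambda a b ∘ blambda (brho b a) c.
Proof.
by rewrite bcircE blambdaD -blambdaM -bcirc_lr blambdaM -bcircE.
Qed.
Lemma brhoM a b c : brho (b ∘ c) a = brho c (brho b a).
Proof.
by rewrite {1 2}/brho blambda_circ binvM -!bcircA.
Qed.
Lemma brho0 a : brho 0 a = a.
Proof. by rewrite /brho blambda0r binv0 bcirc0l bcirc0r. Qed.
Lemma brhoK a : cancel (brho a) (brho a^-1).
Proof. by move=> b; rewrite -brhoM bcircVr brho0. Qed.
Lemma brhoKV a : cancel (brho a^-1) (brho a).
Proof. by move=> b; rewrite -brhoM bcircVl brho0. Qed.

End BraceTheory.

Lemma morph_add0 (B C : skew_brace) (f : B -> C) :
  (forall a b, f (a + b) = f a + f b) -> f (bzero B) = bzero C.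
Proof.
by move=> fD; apply: (@baddI _ (f (bzero B))); rewrite -fD !badd0r.
Qed.

Lemma morph_addN (B C : skew_brace) (f : B -> C) :
  (forall a b, f (a + b) = f a + f b) -> forall a, f (- a) = - f a.
Proof.
by move=> fD a; apply: bopp_uniq; rewrite -fD baddNr morph_add0.
Qed.

(** * The solution attached to a skew brace *)

Section BraceSolution.
Variable B : skew_brace.

Definition brace_r (p : B * B) : B * B := (blambda p.1 p.2, brho p.2 p.1).

Lemma brace_r_bij : bijective brace_r.
Proof.
(* If [(u, v)] is the image of [(a, b)], then [u ∘ v = a ∘ b = a + u], which recovers [a] and then
   [b]. *)
exists (fun p => let a := p.1 ∘ p.2 - p.1 in (a, a^-1 ∘ (p.1 ∘ p.2))).
  case=> a b; rewrite /brace_r /= bcirc_lr.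
  suff -> : a ∘ b - blambda a b = a by rewrite bcircKl.
  by rewrite bcircE baddKr.
case=> u v; rewrite /brace_r /=; set a := u ∘ v - u.
have e : blambda a (a^-1 ∘ (u ∘ v)) = u.
  by apply: (@baddI _ a); rewrite -bcircE bcircKVl /a baddKNr.
by rewrite /brho e -bcircA bcircKVl bcircKl.
Qed.

Lemma brace_r_braid :
  r12 brace_r \o r23 brace_r \o r12 brace_r
    =1 r23 brace_r \o r12 brace_r \o r23 brace_r.
Proof.
case=> [[x y] z] /=; rewrite /brace_r /=.
set u := blambda x y; set v := brho y x; set s := blambda y z.
set t := brho z y.
have e1 : blambda u (blambda v z) = blambda x s.
  by rewrite -!blambdaM bcirc_lr.
have e3 : brho z v = brho t (brho s x).
  by rewrite -!brhoM bcirc_lr.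
(* Both sides of the braid equation preserve the circle product of the three entries; as the outer
   entries agree, so do the middle ones. *)
suff e2 : brho (blambda v z) u = blambda (brho s x) t by rewrite e1 e2 e3.
apply: (@bcircI _ (blambda x s)); rewrite -{1}e1 bcirc_lr.
rewrite -(bcircKr (u ∘ _) (brho z v)).
rewrite -(bcircKr (blambda x s ∘ _) (brho z v)); congr (_ ∘ _).
rewrite -[u ∘ _ ∘ _]bcircA bcirc_lr bcircA bcirc_lr e3 -[RHS]bcircA bcirc_lr.
by rewrite bcircA bcirc_lr -!bcircA bcirc_lr.
Qed.

Lemma brace_lambda_bij (x : B) : bijective (rmap_lambda brace_r x).
Proof. by exists (blambda x^-1); [apply: blambdaK | apply: blambdaKV]. Qed.

Lemma brace_rho_bij (x : B) : bijective (rmap_rho brace_r x).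
Proof. by exists (brho x^-1); [apply: brhoK | apply: brhoKV]. Qed.

Definition brace_solution : solution :=
  Solution (inhabits (bzero B)) brace_r_bij brace_r_braid
    brace_lambda_bij brace_rho_bij.

End BraceSolution.

(** * Congruences of skew braces *)

Section Congruence.
Variables (B : skew_brace) (R : B -> B -> Prop).

Record brace_congruence : Prop := BraceCongruence {
  cong_refl : forall a, R a a;
  cong_sym : forall a b, R a b -> R b a;
  cong_trans : forall a b c, R a b -> R b c -> R a c;
  cong_add : forall a a' b b', R a a' -> R b b' -> R (a + b) (a' + b');
  cong_circ : forall a a' b b', R a a' -> R b b' -> R (a ∘ b) (a' ∘ b')
}.

Hypothesis cR : brace_congruence.

Lemma cong_opp a a' : R a a' -> R (- a) (- a').
Proof.
move=> h; apply: (cong_sym cR); rewrite -{1}[- a'](baddKNr _ a).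
rewrite -[X in R _ X](@badd0l B) -(baddNl a').
rewrite -[- a' + a' + _]baddA -baddA [- a + a]baddNl -{1}(baddNr a).
apply: (cong_add cR); first exact: cong_refl.
by apply: (cong_add cR) => //; apply: cong_refl.
Qed.

Lemma cong_inv a a' : R a a' -> R (a^-1) (a'^-1).
Proof.
move=> h; apply: (cong_sym cR); rewrite -{1}[a'^-1](bcircKVr _ a).
rewrite -[X in R _ X](@bcirc0l B) -(bcircVl a').
rewrite -[a'^-1 ∘ a' ∘ _]bcircA -bcircA [a^-1 ∘ a]bcircVl -{1}(bcircVr a).
apply: (cong_circ cR); first exact: cong_refl.
by apply: (cong_circ cR) => //; apply: cong_refl.
Qed.

Lemma cong_lambda a a' b b' :
  R a a' -> R b b' -> R (blambda a b) (blambda a' b').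
Proof.
by move=> ha hb; apply: (cong_add cR); [exact: cong_opp | exact: (cong_circ cR)].
Qed.

Lemma cong_rho a a' b b' : R a a' -> R b b' -> R (brho a b) (brho a' b').
Proof.
move=> ha hb; do 2?apply: (cong_circ cR) => //.
by apply: cong_inv; apply: cong_lambda.
Qed.

End Congruence.

(** * The terms of the right series define congruences *)

Section RightSeries.
Variable B : skew_brace.
Implicit Types a b c u v z : B.

Lemma add_subgroup_gen_sub (S T : B -> Prop) a :
  (forall b, S b -> T b) -> add_subgroup_gen S a -> add_subgroup_gen T a.
Proof.
move=> sST; elim=> {a} [a /sST||a b _ ha _ hb|a _ ha].
- exact: add_gen_mem.
- exact: add_gen_zero.
- exact: add_gen_add.
- exact: add_gen_opp.
Qed.

Lemma right_series_zero k : right_series k (bzero B).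
Proof. by case: k => [|k] //=; apply: add_gen_zero. Qed.

Lemma right_series_add k a b :
  right_series k a -> right_series k b -> right_series k (a + b).
Proof. by case: k => [|k] //=; apply: add_gen_add. Qed.

Lemma right_series_opp k a : right_series k a -> right_series k (- a).
Proof. by case: k => [|k] //=; apply: add_gen_opp. Qed.

Lemma right_series_star k a b :
  right_series k a -> right_series k.+1 (bstar a b).
Proof. by move=> ha; apply: add_gen_mem; exists a, b. Qed.

Lemma right_series_anti k a : right_series k.+1 a -> right_series k a.
Proof.
elim: k a => [|k IH] a //=; apply: add_subgroup_gen_sub => c [p [b [hp ->]]].
by exists p, b; split=> //; apply: IH.
Qed.

Definition right_series_cong k u v := right_series k (u - v).

Lemma right_series_cong0 k a :
  right_series_cong k a (bzero B) <-> right_series k a.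
Proof. by rewrite /right_series_cong bopp0 badd0r. Qed.

Lemma right_series_normal k a c :
  right_series k a -> right_series k (c + a - c).
Proof.
case: k => // k; elim=> {a} [_ [p [b [hp ->]]]||a b _ ha _ hb|a _ ha].
(* Additive conjugation stays among the generators with the same left entry [p], so normality needs
   no induction on [k]. *)
- have -> : c + bstar p b - c = - bstar p c + bstar p (c + b).
    by rewrite /bstar !boppD !boppK blambdaD -!baddA baddKNl baddKl.
  by apply: add_gen_add; [apply: add_gen_opp|]; apply: right_series_star.
- by rewrite badd0r baddNr; apply: add_gen_zero.
- have -> : c + (a + b) - c = (c + a - c) + (c + b - c).
    by rewrite -!baddA baddKl.
  exact: add_gen_add.
- have -> : c - a - c = - (c + a - c) by rewrite !boppD boppK baddA.
  exact: add_gen_opp.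
Qed.

(** Moving [blambda c] inside [bstar p b] replaces [p] by its circle conjugate under [c]; the
    congruence at level [k] keeps this conjugate in the series. *)
Lemma right_series_lambda k a c :
  brace_congruence (right_series_cong k) ->
  right_series k.+1 a -> right_series k.+1 (blambda c a).
Proof.
move=> cR; elim=> {a} [_ [p [b [hp ->]]]||a b _ ha _ hb|a _ ha].
- have -> : blambda c (bstar p b) = bstar (c ∘ p ∘ c^-1) (blambda c b).
    by rewrite /bstar blambdaD blambdaN !blambdaM blambdaK.
  apply: right_series_star; apply/right_series_cong0.
  have -> : bzero B = c ∘ bzero B ∘ c^-1 by rewrite bcirc0r bcircVr.
  apply: (cong_circ cR); last exact: cong_refl.
  by apply: (cong_circ cR); [apply: cong_refl | apply/right_series_cong0].
- by rewrite blambda0r; apply: add_gen_zero.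
- by rewrite blambdaD; apply: add_gen_add.
- by rewrite blambdaN; apply: add_gen_opp.
Qed.

Lemma right_series_cong_lambda k u v z :
  brace_congruence (right_series_cong k) ->
  right_series_cong k u v ->
  right_series_cong k.+1 (blambda u z) (blambda v z).
Proof.
move=> cR huv; rewrite /right_series_cong.
have -> : blambda u z - blambda v z = blambda v (bstar (v^-1 ∘ u) z).
  by rewrite /bstar blambdaD blambdaN blambdaM blambdaKV.
apply: right_series_lambda => //; apply: right_series_star.
apply/right_series_cong0; rewrite -(bcircVl v).
by apply: (cong_circ cR); first exact: cong_refl.
Qed.

Lemma right_series_congP k : brace_congruence (right_series_cong k).
Proof.
elim: k => [|k IH]; first by split.
have Hadd a a' b b' :
    right_series_cong k.+1 a a' -> right_series_cong k.+1 b b' ->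
    right_series_cong k.+1 (a + b) (a' + b').
  move=> ha hb; rewrite /right_series_cong.
  have -> : a + b - (a' + b') = (a + (b - b') - a) + (a - a').
    by rewrite boppD -!baddA baddKl.
  by apply: right_series_add => //; apply: right_series_normal.
have Htrans a b c : right_series_cong k.+1 a b -> right_series_cong k.+1 b c ->
    right_series_cong k.+1 a c.
  move=> hab hbc; rewrite /right_series_cong.
  have -> : a - c = (a - b) + (b - c) by rewrite -!baddA baddKl.
  exact: right_series_add.
split=> //.
- by move=> a; rewrite /right_series_cong baddNr; apply: right_series_zero.
- move=> a b /right_series_opp; rewrite /right_series_cong boppD boppK.
  exact.
- move=> a a' b b' ha hb; rewrite !bcircE; apply: Hadd => //.
  (* The index and the argument of [blambda] are changed one at a time; only the index change uses
     the induction hypothesis as a gain of one level. *)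
  apply: (Htrans _ (blambda a' b)).
    by apply: right_series_cong_lambda => //; apply: right_series_anti.
  rewrite /right_series_cong -blambdaN -blambdaD.
  exact: right_series_lambda.
Qed.

End RightSeries.

(** * From right nilpotent braces to right nilpotent solutions *)

Section NilpotentBraceSolution.
Variable B : skew_brace.

Lemma brace_lambdaV (x y : brace_solution B) :
  lambdaV x y = blambda (binv (x : B)) y.
Proof.
apply: (can_inj (@blambdaK B x)).
by rewrite blambdaKV; exact: (inverseVK (sol_lambda_bij x) y).
Qed.

Lemma brace_rhoV (x y : brace_solution B) : rhoV x y = brho (binv (x : B)) y.
Proof.
apply: (can_inj (@brhoK B x)).
by rewrite brhoKV; exact: (inverseVK (sol_rho_bij x) y).
Qed.

Lemma in_W_congruence (R : B -> B -> Prop)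
    (m : brace_solution B -> brace_solution B) u v :
  brace_congruence R -> in_W m -> R u v -> R (m u) (m v).
Proof.
move=> cR Wm; elim: Wm u v => {m} [|f g _ IHf _ IHg|x|x|x|x|z] u v huv //.
- by apply: IHf; apply: IHg.
- by apply: (cong_lambda cR) => //; apply: cong_refl.
- by rewrite !brace_lambdaV; apply: (cong_lambda cR) => //; apply: cong_refl.
- by apply: (cong_rho cR) => //; apply: cong_refl.
- by rewrite !brace_rhoV; apply: (cong_rho cR) => //; apply: cong_refl.
- by apply: (cong_rho cR) => //; apply: cong_refl.
Qed.

Lemma brace_lambda_powE e (x y : brace_solution B) :
  lambda_pow e x y = blambda (if e then binv (x : B) else x) y.
Proof. by case: e => //=; apply: brace_lambdaV. Qed.

Lemma lambda_next_congruence k (f f' : B -> B) (s : step (brace_solution B)) :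
  (forall z, right_series_cong k (f z) (f' z)) ->
  forall z, right_series_cong k.+1
    (@lambda_next (brace_solution B) f s z)
    (@lambda_next (brace_solution B) f' s z).
Proof.
move=> ff' z; rewrite /lambda_next !brace_lambda_powE.
have cR := right_series_congP B k.
have h := in_W_congruence cR (W_actP (step_m s)) (ff' (step_v s)).
apply: right_series_cong_lambda => //.
by case: (step_exp s) => //; apply: (cong_inv cR).
Qed.

Lemma lambda_iter_congruence k (f f' : B -> B)
    (s : seq (step (brace_solution B))) :
  (forall z, right_series_cong k (f z) (f' z)) ->
  forall z, right_series_cong (k + size s)%N
    (foldl (@lambda_next (brace_solution B)) f s z)
    (foldl (@lambda_next (brace_solution B)) f' s z).
Proof.
elim: s k f f' => [|t s IH] k f f' ff' /=; first by rewrite addn0.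
by rewrite addnS -addSn; apply/IH/lambda_next_congruence.
Qed.

Lemma right_nilpotent_brace_solution n :
  right_nilpotent_brace n B -> 0 < n ->
  right_nilpotent_solution n (brace_solution B).
Proof.
move=> nilB n0.
have lam1 e (v z : brace_solution B) : right_series_cong 1 (lambda_pow e v z) z.
  rewrite brace_lambda_powE -{2}[z](@blambda0l B).
  exact: (right_series_cong_lambda _ (right_series_congP B 0)).
case: n n0 nilB => [//|[|k]] _ nilB.
  by move=> x z; apply: bsub_eq0; apply/nilB; apply: (lam1 false).
move=> e1 v1 t s sz z; apply: bsub_eq0; apply/nilB.
rewrite /lambda_iter [foldl _ _ (t :: s)]/= -sz -addn2 addnC.
apply: (lambda_iter_congruence _ (k := 2)).
(* The right-hand iteration starts at [lambda_next id t]. Replacing [lambda_pow e1 v1] by [id] is a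
   congruence at level 1; the step [t] raises it to 2 and the remaining [k] steps to [k + 2]. *)
exact: (lambda_next_congruence (k := 1) (f' := id) t (lam1 e1 v1)).
Qed.

End NilpotentBraceSolution.

(** * The structure skew brace and its universal property *)

Section StructureBrace.
Variables (X : solution) (G : skew_brace) (g : X -> G).
Hypothesis hG : is_structure_brace g.
Implicit Types (x y z p q : X) (a b c : G).

Lemma structure_lambdaV x y : g (lambdaV x y) = blambda (g x)^-1 (g y).
Proof. by apply: (@bcircI _ (g x)); rewrite -(structure_add hG) baddE. Qed.

Lemma structure_lambda x y : g (lambda x y) = blambda (g x) (g y).
Proof.
have e : y = lambdaV x (lambda x y) by rewrite /lambdaV inverseK.
by rewrite {2}e structure_lambdaV blambdaKV.
Qed.

Lemma structure_rho y x : g (rho y x) = brho (g y) (g x).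
Proof.
apply: (@bcircI _ (g (lambda x y))).
rewrite [in RHS]structure_lambda bcirc_lr.
have /(structure_presentation hG) : structure_eq
    [:: (false, x); (false, y)] [:: (false, lambda x y); (false, rho y x)].
  by apply: structure_rel; apply: surjective_pairing.
by rewrite /circ_word /circ_letter /= bone_zero !bcirc0r.
Qed.

Lemma structure_rhoV y x : g (rhoV y x) = brho (g y)^-1 (g x).
Proof.
have {2}-> : x = rho y (rhoV y x) by rewrite /rhoV /rho inverseVK.
by rewrite structure_rho brhoK.
Qed.

Lemma structure_ind (P : G -> Prop) :
  P (bzero G) ->
  (forall l a, P a -> P (circ_letter g l ∘ a)) -> forall a, P a.
Proof.
move=> P0 PM a; case: (structure_gen hG a) => w <-.
by elim: w => [|l w IH]; rewrite /= ?bone_zero //; apply: PM.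
Qed.

(** Peel a letter off a word by [l ∘ a = l + blambda l a]. The action of a letter maps generators to
    generators, and an inverse letter is minus a generator by [binvE]. *)
Lemma structure_add_gen a : add_subgroup_gen (fun b => exists x, b = g x) a.
Proof.
elim/structure_ind: a => [|[e x] a IH]; first exact: add_gen_zero.
have lam c : add_subgroup_gen (fun b => exists x, b = g x) c ->
    add_subgroup_gen (fun b => exists x, b = g x)
      (blambda (circ_letter g (e, x)) c).
  elim=> {c} [_ [y ->]||b c _ hb _ hc|b _ hb].
  - case: e; rewrite /circ_letter /= -?structure_lambdaV -?structure_lambda;
      apply: add_gen_mem; by eexists.
  - by rewrite blambda0r; apply: add_gen_zero.
  - by rewrite blambdaD; apply: add_gen_add.
  - by rewrite blambdaN; apply: add_gen_opp.
rewrite bcircE; apply: add_gen_add; last exact: lam.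
case: e {lam}; rewrite /circ_letter /=.
  rewrite binvE -structure_lambdaV; apply: add_gen_opp.
  by apply: add_gen_mem; eexists.
by apply: add_gen_mem; eexists.
Qed.

Lemma structure_morphism_uniq (K : skew_brace) (phi psi : G -> K) :
  brace_morphism phi -> brace_morphism psi ->
  phi \o g =1 psi \o g -> phi =1 psi.
Proof.
case=> phiD _ [psiD _] e a.
elim: (structure_add_gen a) => {a} [_ [x ->]||a b _ ha _ hb|a _ ha].
- exact: e.
- by rewrite !morph_add0.
- by rewrite phiD psiD ha hb.
- by rewrite !morph_addN // ha.
Qed.

Section Universal.
Variables (K : skew_brace) (h : X -> brace_solution K).
Hypothesis hom_h : solution_morphism h.
Let hK : X -> K := h.

Lemma hom_lambda x y : hK (lambda x y) = blambda (hK x) (hK y).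
Proof. by have [] := hom_h x y. Qed.

Lemma hom_rho y x : hK (rho y x) = brho (hK y) (hK x).
Proof. by have [] := hom_h x y. Qed.

Lemma circ_word_cat w w' :
  circ_word hK (w ++ w') = circ_word hK w ∘ circ_word hK w'.
Proof.
elim: w => [|l w IH] /=; first by rewrite bone_zero bcirc0l.
by rewrite IH bcircA.
Qed.

Lemma circ_word_structure_eq w w' :
  structure_eq w w' -> circ_word hK w = circ_word hK w'.
Proof.
elim=> {w w'} //.
- by move=> w w' w'' _ -> _ ->.
- by move=> w1 w1' w2 w2' _ e1 _ e2; rewrite !circ_word_cat e1 e2.
- move=> e x; rewrite /circ_word /circ_letter /= bone_zero bcirc0r.
  by case: e => /=; rewrite (bcircVl, bcircVr).
- move=> x y u v e; rewrite /circ_word /circ_letter /= bone_zero !bcirc0r.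
  have [-> ->] : u = lambda x y /\ v = rho y x.
    by rewrite /lambda /rho /rmap_lambda /rmap_rho e.
  by rewrite hom_lambda hom_rho bcirc_lr.
Qed.

Lemma structure_universal :
  exists phi : G -> K, brace_morphism phi /\ phi \o g =1 h.
Proof.
pose word a :=
  proj1_sig (constructive_indefinite_description _ (structure_gen hG a)).
have wordP a : circ_word g (word a) = a.
  by rewrite /word; case: constructive_indefinite_description.
pose phi a := circ_word hK (word a).
have phiW w : phi (circ_word g w) = circ_word hK w.
  by apply: circ_word_structure_eq; apply/(structure_presentation hG).
have phiC a b : phi (a ∘ b) = phi a ∘ phi b.
  rewrite -circ_word_cat -phiW; congr phi; rewrite -{1}(wordP a) -{1}(wordP b).
  elim: (word a) => [|l w IH] /=; first by rewrite bone_zero bcirc0l.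
  by rewrite -IH bcircA.
have phig x : phi (g x) = hK x.
  have := phiW [:: (false, x)].
  by rewrite /circ_word /circ_letter /= !bone_zero !bcirc0r.
have phi0 : phi (bzero G) = bzero K.
  by have := phiW [::]; rewrite /= !bone_zero.
have phiV a : phi a^-1 = (phi a)^-1.
  by apply: binv_uniq; rewrite -phiC bcircVr.
(* A word for [a] moves [y] inside [X], and [h] respects this action, so a single [y'] serves in
   both [G] and [K]. *)
have phiL a y :
    exists2 y', blambda a (g y) = g y' & blambda (phi a) (hK y) = hK y'.
  elim/structure_ind: a => [|[e x] a [y' e1 e2]].
    by exists y; rewrite ?phi0 blambda0l.
  rewrite phiC !blambdaM e1 e2; case: e; rewrite /circ_letter /= ?phiV phig.
    exists (lambdaV x y'); first by rewrite structure_lambdaV.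
    have {1}-> : y' = lambda x (lambdaV x y').
      by rewrite /lambdaV /lambda inverseVK.
    by rewrite hom_lambda blambdaK.
  by exists (lambda x y'); rewrite ?structure_lambda ?hom_lambda.
(* [baddE] turns adding a generator into a circle product. As the generators span [(G, +)], full
   additivity follows. *)
have phiDg a x : phi (a + g x) = phi a + phi (g x).
  rewrite !baddE phiC; congr (_ ∘ _); rewrite phig -phiV.
  by have [y' -> ->] := phiL a^-1 x.
exists phi; split; last exact: phig.
split=> // a b; elim: (structure_add_gen b) a
  => {b} [_ [x ->]|a|b c _ hb _ hc a|b _ hb a].
- by move=> a; apply: phiDg.
- by rewrite phi0 !badd0r.
- by rewrite baddA hc hb hc baddA.
- have sub c : phi (c - b) = phi c - phi b.
    by rewrite -[in RHS](baddKNr c b) hb baddKr.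
  by rewrite sub -[- b]badd0l sub phi0 badd0l.
Qed.

End Universal.
End StructureBrace.

(** * Strong left ideals and trivial action modulo them *)

Record strong_left_ideal (B : skew_brace) (J : B -> Prop) : Prop :=
  StrongLeftIdeal {
    sli_zero : J (bzero B);
    sli_add : forall a b, J a -> J b -> J (a + b);
    sli_opp : forall a, J a -> J (- a);
    sli_normal : forall c a, J a -> J (c + a - c);
    sli_lambda : forall c a, J a -> J (blambda c a)
  }.

(** For a strong left ideal [J] this is the kernel of the action of the circle group on the quotient
    of [(B, +)] by [J], hence a normal subgroup of the circle group. *)
Definition acts_trivially (B : skew_brace) (J : B -> Prop) (a : B) : Prop :=
  forall b, J (bstar a b).

Section ActsTrivially.
Variables (B : skew_brace) (J : B -> Prop).
Hypothesis sJ : strong_left_ideal J.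

Lemma acts_trivially0 : acts_trivially J (bzero B).
Proof. by move=> z; rewrite /bstar blambda0l baddNr; apply: sli_zero. Qed.

Lemma acts_triviallyM a b :
  acts_trivially J a -> acts_trivially J b -> acts_trivially J (a ∘ b).
Proof.
move=> ha hb z; have -> : bstar (a ∘ b) z = bstar a (blambda b z) + bstar b z.
  by rewrite /bstar blambdaM baddA baddKNr.
exact: sli_add.
Qed.

Lemma acts_triviallyV a : acts_trivially J a -> acts_trivially J a^-1.
Proof.
move=> ha z; have -> : bstar a^-1 z = - bstar a (blambda a^-1 z).
  by rewrite /bstar blambdaKV boppD boppK.
exact: sli_opp.
Qed.

Lemma acts_triviallyJ c a :
  acts_trivially J a -> acts_trivially J (c ∘ a ∘ c^-1).
Proof.
move=> ha z.
have -> : bstar (c ∘ a ∘ c^-1) z = blambda c (bstar a (blambda c^-1 z)).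
  by rewrite /bstar blambdaD blambdaN !blambdaM blambdaKV.
exact: sli_lambda.
Qed.

End ActsTrivially.

Inductive normal_closure (B : skew_brace) (S : B -> Prop) : B -> Prop :=
  | normal_mem a : S a -> normal_closure S a
  | normal_zero : normal_closure S (bzero B)
  | normal_add a b : normal_closure S a -> normal_closure S b ->
      normal_closure S (a + b)
  | normal_opp a : normal_closure S a -> normal_closure S (- a)
  | normal_conj c a : normal_closure S a -> normal_closure S (c + a - c).

(** * Ideals of the structure brace generated by differences *)

Section StructureIdeals.
Variables (X : solution) (G : skew_brace) (g : X -> G).
Hypothesis hG : is_structure_brace g.
Implicit Types (x y z p q : X) (a b c : G) (R : X -> X -> Prop).

Definition difference_ideal R : G -> Prop :=
  normal_closure (fun d => exists x y, R x y /\ d = g x - g y).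

Lemma difference_ideal_mem R x y : R x y -> difference_ideal R (g x - g y).
Proof. by move=> h; apply: normal_mem; exists x, y. Qed.

Lemma difference_ideal_sub R R' a :
  (forall x y, R x y -> R' x y) ->
  difference_ideal R a -> difference_ideal R' a.
Proof.
move=> sRR'; elim=> {a} [_ [x [y [/sRR' h ->]]]||a b _ ha _ hb|a _ ha|c a _ ha].
- exact: difference_ideal_mem.
- exact: normal_zero.
- exact: normal_add.
- exact: normal_opp.
- exact: normal_conj.
Qed.

Lemma difference_ideal_ker R a :
  (forall x y, R x y -> g x = g y) -> difference_ideal R a -> a = bzero G.
Proof.
move=> kR; elim=> {a} [_ [x [y [/kR h ->]]]||a b _ -> _ ->|a _ ->|c a _ ->] //.
- by rewrite h baddNr.
- by rewrite badd0l.
- by rewrite bopp0.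
- by rewrite badd0r baddNr.
Qed.

(** The maps [D_z] in [W] let the index of [rho] vary along [R]; [wcong_lambda] adds this for
    [lambda]. [wcong_ker] contains reflexivity and lets identities proved in [G] be used in [X]. *)
Record W_congruence R : Prop := WCongruence {
  wcong_ker : forall x y, g x = g y -> R x y;
  wcong_sym : forall x y, R x y -> R y x;
  wcong_trans : forall x y z, R x y -> R y z -> R x z;
  wcong_W : forall (m : X -> X) x y, in_W m -> R x y -> R (m x) (m y);
  wcong_lambda : forall x y z, R x y -> R (lambda x z) (lambda y z)
}.

(** A word for [c] acts on [x] and [y] through the same maps of [W]. *)
Lemma wcong_structure_lambda R c x y : W_congruence R -> R x y ->
  exists x' y', [/\ R x' y', blambda c (g x) = g x' & blambda c (g y) = g y'].
Proof.
move=> cR hxy; elim/(structure_ind hG): c => [|[e z] c [x' [y' [h e1 e2]]]].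
  by exists x, y; rewrite !blambda0l.
rewrite !blambdaM e1 e2 /circ_letter; case: e => /=.
  exists (lambdaV z x'), (lambdaV z y'); rewrite !(structure_lambdaV hG).
  by split=> //; apply: (wcong_W cR) => //; apply: W_lambdaV.
exists (lambda z x'), (lambda z y'); rewrite !(structure_lambda hG).
by split=> //; apply: (wcong_W cR) => //; apply: W_lambda.
Qed.

Lemma difference_idealP R :
  W_congruence R -> strong_left_ideal (difference_ideal R).
Proof.
move=> cR; split; try by constructor.
move=> c a; elim=> {a} [_ [x [y [h ->]]]||a b _ ha _ hb|a _ ha|d a _ ha].
- have [x' [y' [h' e1 e2]]] := wcong_structure_lambda c cR h.
  by rewrite blambdaD blambdaN e1 e2; apply: difference_ideal_mem.
- by rewrite blambda0r; apply: normal_zero.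
- by rewrite blambdaD; apply: normal_add.
- by rewrite blambdaN; apply: normal_opp.
- by rewrite !blambdaD blambdaN; apply: normal_conj.
Qed.

(** The elements fixed by [blambda a] modulo a normal subgroup form an additive subgroup, so it
    suffices to test generators of [(G, +)]. *)
Lemma acts_trivially_gen R a : W_congruence R ->
  (forall x, difference_ideal R (bstar a (g x))) ->
  acts_trivially (difference_ideal R) a.
Proof.
move=> cR h b.
elim: (structure_add_gen hG b) => {b} [_ [x ->]||b c _ hb _ hc|b _ hb].
- exact: h.
- by rewrite /bstar blambda0r baddNr; apply: normal_zero.
- have -> : bstar a (b + c) = bstar a b + (b + bstar a c - b).
    by rewrite /bstar blambdaD boppD !baddA baddKNr.
  by apply: normal_add => //; apply: normal_conj.
- have -> : bstar a (- b) = - b + (- bstar a b) - (- b).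
    by rewrite /bstar blambdaN boppD !boppK !baddA baddNl badd0l.
  by apply: normal_conj; apply: normal_opp.
Qed.

(* [u] below is the image of [q] under a twisted diagonal of the solution; for
   [p = q] it would be [q] itself, so that [u] is congruent to [q]. *)
Lemma difference_circ R p q : W_congruence R -> R p q ->
  exists2 u, R p u & g p - g q = g p ∘ (g u)^-1.
Proof.
move=> cR hpq; pose t := lambdaV p q; pose u := rhoV t t.
(* Both directions cancel in [bcirc_lr]. *)
have fixed v w : blambda (g v) (g w) = g v <-> brho (g w) (g v) = g w.
  rewrite /brho; split=> [->|e]; first by rewrite -bcircA bcircKl.
  have := bcirc_lr (g v) (g w); rewrite /brho e => e'.
  by rewrite -[LHS](bcircKr _ (g w)) e' bcircKr.
pose t0 := lambdaV q q.
have ht : R t t0.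
  have e : lambda q t0 = q by rewrite /lambda /lambdaV inverseVK.
  have -> : t0 = lambdaV p (lambda p t0) by rewrite /lambda /lambdaV inverseK.
  rewrite /t -{1}e; apply: (wcong_W cR (W_lambdaV p)).
  by apply: (wcong_sym cR); apply: (wcong_lambda cR).
(* [t0] is the value of [t] at [p = q], and [rho t0 q] agrees with [t0] in [G]. So [u = rhoV t t] is
   related to [rhoV t t0], to [rhoV t (rho t0 q)] and to [rhoV t (rho t q) = q]. *)
have hu : R u q.
  apply: (wcong_trans cR) (wcong_W cR (W_rhoV t) ht) _.
  have <- : rhoV t (rho t q) = q by rewrite /rhoV /rho inverseK.
  apply: (wcong_W cR (W_rhoV t)); apply: (wcong_trans cR (y := rho t0 q)).
    apply: (wcong_ker cR); rewrite (structure_rho hG); apply/esym/fixed.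
    by rewrite (structure_lambdaV hG) blambdaKV.
  by apply: (wcong_W cR (W_D q)); apply: (wcong_sym cR).
exists u; first exact: (wcong_trans cR hpq (wcong_sym cR hu)).
rewrite baddE blambdaN -(structure_lambdaV hG); congr (_ ∘ _).
rewrite binvE; congr (- _); apply: (can_inj (blambdaK (g u))).
rewrite blambdaKV; apply/fixed.
by rewrite (structure_rhoV hG) brhoKV.
Qed.

(* The hypothesis that [difference_ideal R'] acts trivially modulo itself makes
   it a two-sided ideal; it replaces the invariance of [R] under conjugation
   in [(G, +)], which does not follow from that under [W]. *)
Lemma difference_ideal_step R R' :
  W_congruence R -> W_congruence R' ->
  (forall x y z, R x y -> R' (lambda x z) (lambda y z)) ->
  (forall a, difference_ideal R' a -> acts_trivially (difference_ideal R') a) ->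
  forall a, difference_ideal R a -> acts_trivially (difference_ideal R') a.
Proof.
move=> cR cR' lamRR' JK a La; set J := difference_ideal R'.
have sJ : strong_left_ideal J by apply: difference_idealP.
(* Stable under [blambda], the claim survives sums, since [a + c] is [a ∘ blambda a^-1 c]. *)
suff: forall b, acts_trivially J (blambda b a).
  by move/(_ (bzero G)); rewrite blambda0l.
elim: La => {a} [_ [x [y [h ->]]]||a c _ ha _ hc|a _ ha|c a _ ha] b.
- have [p [q [hpq e1 e2]]] := wcong_structure_lambda b cR h.
  rewrite blambdaD blambdaN e1 e2.
  have [u hpu ->] := difference_circ cR hpq.
  apply: acts_trivially_gen => // z.
  rewrite /bstar blambdaM -(structure_lambdaV hG) -(structure_lambda hG).
  apply: difference_ideal_mem.
  (* Both terms now apply [lambda], with the related indices [p] and [u], to the same point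
     [lambdaV u z]. *)
  have {2}-> : z = lambda u (lambdaV u z) by rewrite /lambda /lambdaV inverseVK.
  exact: lamRR'.
- by rewrite blambda0r; apply: acts_trivially0.
- rewrite blambdaD baddE -blambdaM.
  by apply: acts_triviallyM; [|apply: ha|apply: hc].
- by rewrite blambdaN boppE -blambdaM; apply: acts_triviallyV.
- rewrite !blambdaD blambdaN; set c' := blambda b c; set a' := blambda b a.
  (* Since [c' ∘ a2 = c' + a'], the additive conjugate [d] differs from the circle conjugate of [a2]
     by an element [j] of [J], and [j] acts trivially by [JK]. *)
  set d := c' + a' - c'; pose a2 := blambda c'^-1 a'.
  have ha2 : acts_trivially J a2 by rewrite /a2 -blambdaM; apply: ha.
  pose j := blambda c' (- c'^-1 + bstar a2 c'^-1 - - c'^-1).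
  have Jj : J j by apply: (sli_lambda sJ); apply: (sli_normal sJ).
  have e : c' ∘ a2 ∘ c'^-1 = d + j.
    have ec : blambda c' c'^-1 = - c' by rewrite binvE blambdaN blambdaKV.
    rewrite bcircE -baddE /d /j -[_ - c' + _]baddA; congr (_ + _).
    rewrite /bstar boppK [- _ + (_ - _)]baddA baddKNr blambdaD blambdaN ec.
    by rewrite boppK baddKl baddE blambdaM.
  have -> : d = c' ∘ a2 ∘ c'^-1 ∘ (blambda d^-1 j)^-1.
    by rewrite e baddE bcircKr.
  apply: acts_triviallyM => //; first exact: acts_triviallyJ.
  apply: acts_triviallyV => //; apply: JK; exact: (sli_lambda sJ).
Qed.

(** * The level relations and right nilpotency of the structure brace *)

(* [level_ker] is needed because [g] need not be injective. *)
Inductive level_rel : nat -> X -> X -> Prop :=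
  | level_ker k x y : g x = g y -> level_rel k x y
  | level_sym k x y : level_rel k x y -> level_rel k y x
  | level_trans k x y z :
      level_rel k x y -> level_rel k y z -> level_rel k x z
  | level_W k (m : X -> X) x y :
      in_W m -> level_rel k x y -> level_rel k (m x) (m y)
  | level_base v x : level_rel 0 (lambda v x) x
  | level_step k x y z :
      level_rel k x y -> level_rel k.+1 (lambda x z) (lambda y z).

(** Induction on the derivation. A step landing at level 1 has no lower step to fall back on, but
    then both sides are related to [z] by [level_base]. *)
Lemma level_anti k x y : level_rel k.+1 x y -> level_rel k x y.
Proof.
move ej: k.+1 => j h; elim: h k ej => {j x y}.
- by move=> j x y e k _; apply: level_ker.
- by move=> j x y _ IH k /IH; apply: level_sym.
- by move=> j x y z _ IH1 _ IH2 k e; apply: level_trans (IH1 _ e) (IH2 _ e).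
- by move=> j m x y Wm _ IH k /IH; apply: level_W.
- by [].
- move=> j x y z _ IH [|k] [e]; last by apply: level_step; apply: IH.
  exact: (level_trans (level_base x z) (level_sym (level_base y z))).
Qed.

Lemma level_congruence k : W_congruence (level_rel k).
Proof.
split; [exact: level_ker|exact: level_sym|exact: level_trans|exact: level_W|].
by move=> x y z h; apply/level_anti/level_step.
Qed.

(** Level 0 makes every generator, hence all of [G], act trivially modulo its ideal; [act] then
    lifts this one level at a time. *)
Lemma right_series_level k a :
  (forall j b, difference_ideal (level_rel j) b ->
     acts_trivially (difference_ideal (level_rel j.+1)) b) ->
  right_series k.+1 a -> difference_ideal (level_rel k) a.
Proof.
move=> act; elim: k a => [|k IH] a;
  elim=> {a} [_ [p [b [hp ->]]]||a b _ ha _ hb|a _ ha];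
  try solve [exact: normal_zero | exact: normal_add | exact: normal_opp].
- suff: acts_trivially (difference_ideal (level_rel 0)) p by apply.
  have sJ := difference_idealP (level_congruence 0).
  elim/(structure_ind hG): p {hp} => [|[e x] p hp].
    exact: acts_trivially0.
  apply: acts_triviallyM => //.
  suff hx : acts_trivially (difference_ideal (level_rel 0)) (g x).
    by case: e => //; apply: acts_triviallyV.
  apply: acts_trivially_gen; first exact: level_congruence.
  move=> z; rewrite /bstar -(structure_lambda hG).
  exact/difference_ideal_mem/level_base.
- by apply: act; apply: IH.
Qed.

Lemma ker_W (m : X -> X) x y : in_W m -> g x = g y -> g (m x) = g (m y).
Proof.
move=> Wm; elim: Wm x y => {m} [|f f' _ IHf _ IHf'|v|v|v|v|z] x y e //.
- by apply: IHf; apply: IHf'.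
- by rewrite !(structure_lambda hG) e.
- by rewrite !(structure_lambdaV hG) e.
- by rewrite !(structure_rho hG) e.
- by rewrite !(structure_rhoV hG) e.
- by rewrite !(structure_rho hG) e.
Qed.

Lemma ker_foldl (f f' : X -> X) (s : seq (step X)) :
  (forall z, g (f z) = g (f' z)) ->
  forall z,
    g (foldl (@lambda_next X) f s z) = g (foldl (@lambda_next X) f' s z).
Proof.
elim: s f f' => [//|t s IH] f f' ff' /=; apply: IH => z.
rewrite /lambda_next; have := ker_W (W_actP (step_m t)) (ff' (step_v t)).
move: (step_m t _) (step_m t _) => p q e.
case: (step_exp t) => /=.
  by rewrite !(structure_lambdaV hG) e.
by rewrite !(structure_lambda hG) e.
Qed.

(** Nilpotency speaks of [k + 2] nested maps. A derivation at level [j] accounts for [j] of the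
    steps and [s] for the others; general [m] and [s] absorb the cases [level_W] and [level_step],
    and [level_base] is the nilpotency identity itself. *)
Lemma level_foldl k j x y (m : X -> X) (s : seq (step X)) :
  right_nilpotent_solution k.+2 X -> level_rel j x y -> (j + size s)%N = k ->
  in_W m -> forall z,
  g (foldl (@lambda_next X) (lambda (m x)) s z) =
  g (foldl (@lambda_next X) (lambda (m y)) s z).
Proof.
move=> nilX h; elim: h m s => {j x y}.
- move=> j x y e m s _ Wm; apply: ker_foldl => z.
  by rewrite !(structure_lambda hG) (ker_W Wm e).
- by move=> j x y _ IH m s es Wm z; apply/esym/IH.
- move=> j x y z _ IH1 _ IH2 m s es Wm t.
  exact: etrans (IH1 _ _ es Wm t) (IH2 _ _ es Wm t).
- move=> j m x y Wm _ IH m' s es Wm'.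
  by apply: (IH (m' \o m)) => //; apply: W_comp.
- move=> v x m s es Wm z; congr g.
  exact: (nilX false v (Step false (MkW Wm) x) s es z).
- move=> j x y v _ IH m s es Wm z.
  apply: (IH id (Step false (MkW Wm) v :: s)); last exact: W_id.
  by rewrite /= addnS -addSn.
Qed.

Lemma level_ker_of_nilpotent n x y :
  right_nilpotent_solution n.+1 X -> level_rel n x y -> g x = g y.
Proof.
move=> nilX h; elim: h nilX => {n x y} //.
- by move=> n x y _ IH /IH.
- by move=> n x y z _ IH1 _ IH2 nilX; rewrite IH1 ?IH2.
- by move=> n m x y Wm _ IH /IH; apply: ker_W.
- by move=> v x nilX; rewrite (nilX v x).
- move=> n x y z h _ nilX.
  exact: (level_foldl (s := [::]) nilX h (addn0 n) (W_id X) z).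
Qed.

Lemma structure_right_nilpotent n :
  right_nilpotent_solution n.+1 X -> right_nilpotent_brace n.+1 G.
Proof.
move=> nilX.
have kerN k x y : n <= k -> level_rel k x y -> g x = g y.
  move=> nk h; apply: level_ker_of_nilpotent nilX _.
  elim: k nk h => [|k IH]; first by rewrite leqn0 => /eqP ->.
  by rewrite leq_eqVlt => /orP[/eqP -> //|nk /level_anti]; apply: IH.
(* Descending induction on [k], with [d] bounding [n - k]. For [k >= n] the ideal is zero. *)
have act d : forall k, n <= (k + d)%N -> forall a,
    difference_ideal (level_rel k) a ->
    acts_trivially (difference_ideal (level_rel k.+1)) a.
  elim: d => [|d IH] k hk.
    rewrite addn0 in hk.
    move=> a /difference_ideal_ker ->; last by move=> x y; apply: kerN.
    by apply: acts_trivially0; apply: difference_idealP (level_congruence _).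
  apply: difference_ideal_step; try exact: level_congruence.
    by move=> x y z; apply: level_step.
  (* The induction hypothesis gives trivial action modulo level [k + 2], which lies inside level
     [k + 1]. *)
  move=> a /(IH k.+1 _ a) ha b; apply: difference_ideal_sub (ha _ b).
    exact: level_anti.
  by rewrite addSn -addnS.
move=> a; split=> [/right_series_level h|->]; last exact: right_series_zero.
apply: difference_ideal_ker (h _); first by move=> x y; apply: kerN.
by move=> j; apply: (act n); apply: leq_addl.
Qed.

End StructureIdeals.

(** * Transfer of freeness from solutions to skew braces *)

Theorem theoremB (n : nat) (hn : 1 <= n) (X : Type) (hX : inhabited X)
    (F : solution) (i : X -> F) (hF : is_free_RNS n i)
    (G : skew_brace) (gF : F -> G) (hG : is_structure_brace gF) :
  is_free_RN n (gF \o i).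
Proof.
case: hF => nilF univF.
split=> [|K nilK f].
  case: n hn nilF {univF} => // n _ nilF.
  exact: (structure_right_nilpotent hG nilF).
have [h [hom_h hi uniq_h]] :=
  univF (brace_solution K) (right_nilpotent_brace_solution nilK hn) f.
have [phi [hom_phi phig]] := structure_universal hG hom_h.
exists phi; split=> // [x|psi hom_psi psi_i]; first by rewrite /= -hi /= -phig.
apply: (structure_morphism_uniq hG) => // x.
(* [psi \o gF] is a morphism of solutions into [brace_solution K] extending [f], so it equals [h] by
   freeness of [F]. *)
rewrite [RHS]phig; apply: (uniq_h (psi \o gF)) => // {}x y.
case: hom_psi => psiD psiC.
have psiN := morph_addN psiD.
have psiV a : psi a^-1 = (psi a)^-1.
  by apply: binv_uniq; rewrite -psiC bcircVr (morph_add0 psiD).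
rewrite /= /brace_r /=; congr pair.
  rewrite [RHS](congr1 psi (structure_lambda hG x y)) /blambda.
  by rewrite psiD psiN psiC.
rewrite [RHS](congr1 psi (structure_rho hG y x)) /brho /blambda.
by rewrite !psiC psiV psiD psiN psiC.
Qed.
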